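(* For all $d\ge2$ and $n\ge3$, $$\dim\mathbb X_{n-1,d}=\dim\mathbb X_{n-1,[d-1,1]}=\binom{d+n-2}{n-1}+n-2.$$
   Context: Let $\mathbb K$ be an algebraically closed field of characteristic zero and $S=\mathbb K[x_1,\ldots,x_n]=\bigoplus_{i\ge0}[S]_i$ the standard graded polynomial ring. Put $N=\binom{d+n-1}{n-1}$. For $1\le k\le\lfloor d/2\rfloor$ let $$\mathbb X_{n-1,[d-k,k]}=\{[F]\in\mathbb P([S]_d)=\mathbb P^{N-1}\mid F=F_1F_2,\ 0\ne F_1\in[S]_{d-k},\ 0\neq F_2\in[S]_k\}.$$ The variety of reducible forms of degree $d$ in $n$ variables is $$\mathbb X_{n-1,d}=\bigcup_{k=1}^{\lfloor d/2\rfloor}\mathbb X_{n-1,[d-k,k]}\subset\mathbb P^{N-1}.$$ *)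

(* Defs.v *)
From HB Require Import structures.
From mathcomp Require Import all_boot all_order all_algebra.
From mathcomp Require Import boolp classical_sets topology_structure.
From mathcomp Require Import mpoly.

Set Implicit Arguments.
Unset Strict Implicit.
Unset Printing Implicit Defensive.

Import GRing.Theory.

Local Open Scope classical_set_scope.
Local Open Scope ring_scope.

Section KrullDimension.
Variable T : topologicalType.
Implicit Types A Z : set T.

Definition closed_in A Z := exists2 C, closed C & Z = A `&` C.

Definition irreducible_set Z :=
  Z !=set0 /\
  forall C1 C2, closed C1 -> closed C2 ->
    Z `<=` C1 `|` C2 -> Z `<=` C1 \/ Z `<=` C2.

(* A chain c 0 < c 1 < ... < c m has length m, as usual for the Krull
   dimension. *)
Definition irreducible_chain A (m : nat) (c : nat -> set T) :=
  (forall i, (i <= m)%N -> closed_in A (c i) /\ irreducible_set (c i)) /\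
  (forall i, (i < m)%N -> c i `<` c i.+1).

Definition has_krull_dim A (m : nat) :=
  (exists c, irreducible_chain A m c) /\
  (forall m' c, irreducible_chain A m' c -> (m' <= m)%N).

End KrullDimension.

(* The points of the projective space P(V) are the lines of V. *)
Definition projspace (K : fieldType) (V : vectType K) :=
  {U : {vspace V} | \dim U == 1%N}.

Section Zariski.
Variables (K : fieldType) (V : vectType K).
Implicit Types (f g : {mpoly K[\dim {:V}]}) (P : projspace V).

HB.instance Definition _ := Choice.on (projspace V).

(* Homogeneous coordinates in some basis of V; the Zariski topology below does
   not depend on the basis. *)
Definition coords (v : V) : 'I_(\dim {:V}) -> K :=
  fun i => coord (vbasis fullv) i v.

Definition vanishes_at f P := forall v, v \in val P -> f.@[coords v] = 0.

Definition zero_locus (E : set {mpoly K[\dim {:V}]}) : set (projspace V) :=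
  [set P | forall f, E f -> vanishes_at f P].

Definition homogeneous_set (E : set {mpoly K[\dim {:V}]}) :=
  forall f, E f -> exists e, f \is e.-homog.

Definition zariski_closed (A : set (projspace V)) :=
  exists2 E, homogeneous_set E & A = zero_locus E.

Definition zariski_open (A : set (projspace V)) := zariski_closed (~` A).

Lemma meval_coordsZ f e a v :
  f \is e.-homog -> f.@[coords (a *: v)] = a ^+ e * f.@[coords v].
Proof.
move=> hf; rewrite !mevalE big_distrr /= big_seq [RHS]big_seq.
apply: eq_bigr => m mf; rewrite mulrCA; congr (_ * _).
rewrite -(dhomogP _ _ _ hf m mf) /= mdegE -prodrXr -big_split /=.
by apply: eq_bigr => i _; rewrite /coords linearZ /= exprMn.
Qed.

Lemma projspaceP P : exists2 u : V, u != 0 & val P = <[u]>%VS.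
Proof.
case: P => U /= dU; have dU1 : \dim U = 1%N by apply/eqP.
exists (vpick U); first by rewrite vpick0 -dimv_eq0 dU1.
apply/esym/eqP; rewrite eqEdim -memvE memv_pick dU1 dim_vline vpick0.
by rewrite -dimv_eq0 dU1.
Qed.

Lemma vanishes_at_line f e P (u : V) : f \is e.-homog -> val P = <[u]>%VS ->
  vanishes_at f P <-> f.@[coords u] = 0.
Proof.
move=> hf Pu; rewrite /vanishes_at Pu; split=> [|fu v /vlineP[a ->]]; first by apply; exact: memv_line.
by rewrite (meval_coordsZ _ _ hf) fu mulr0.
Qed.

Lemma zariski_closed0 : zariski_closed set0.
Proof.
exists [set 1]; first by move=> f ->; exists 0%N; exact: dhomog1.
apply/seteqP; split=> // P /(_ 1 erefl); have [u _ Pu] := projspaceP P.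
by move/(vanishes_at_line (dhomog1 _ _) Pu)/eqP; rewrite meval1 oner_eq0.
Qed.

Lemma zariski_closedU A B :
  zariski_closed A -> zariski_closed B -> zariski_closed (A `|` B).
Proof.
move=> [E hE ->] [F hF ->].
exists [set h | exists f g, [/\ E f, F g & h = f * g]].
  move=> _ [f [g [/hE[a fa] /hF[b gb] ->]]]; exists (a + b)%N.
  exact: dhomogM.
apply/seteqP; split=> P.
  move=> [EP|FP] _ [f [g [Ef Fg ->]]] v Pv; rewrite mevalM.
    by rewrite (EP f Ef v Pv) mul0r.
  by rewrite (FP g Fg v Pv) mulr0.
have [u _ Pu] := projspaceP P.
move=> EFP; have [?|/existsNP[f /not_implyP[Ef nf]]] := pselect (zero_locus E P);
  first by left.
right=> g Fg; have [a fa] := hE f Ef; have [b gb] := hF g Fg.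
apply/(vanishes_at_line gb Pu); have fg : vanishes_at (f * g) P.
  by apply: EFP; exists f, g.
move/(vanishes_at_line (dhomogM fa gb) Pu)/eqP: fg; rewrite mevalM mulf_eq0.
by case/orP=> /eqP // /(vanishes_at_line fa Pu).
Qed.

Lemma zariski_closed_bigcap (I : Type) (A : I -> set (projspace V)) :
  (forall i, zariski_closed (A i)) -> zariski_closed (\bigcap_i A i).
Proof.
move=> cA; exists [set f | exists i E,
    [/\ homogeneous_set E, A i = zero_locus E & E f]].
  by move=> f [i [E [hE _ /hE]]].
apply/seteqP; split=> P.
  by move=> AP f [i [E [_ AE Ef]]]; have := AP i Logic.I; rewrite AE; apply.
move=> h i _; have [E hE AE] := cA i; rewrite AE => f Ef.
by apply: h; exists i, E.
Qed.

Lemma zariski_openT : zariski_open setT.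
Proof. by rewrite /zariski_open setCT; exact: zariski_closed0. Qed.

Lemma zariski_openI : setI_closed zariski_open.
Proof. by move=> A B ? ?; rewrite /zariski_open setCI; exact: zariski_closedU. Qed.

Lemma zariski_open_bigcup (I : Type) (A : I -> set (projspace V)) :
  (forall i, zariski_open (A i)) -> zariski_open (\bigcup_i A i).
Proof.
by move=> ?; rewrite /zariski_open setC_bigcup; exact: zariski_closed_bigcap.
Qed.

HB.instance Definition _ := isOpenTopological.Build (projspace V)
  zariski_openT zariski_openI zariski_open_bigcup.

Lemma projspace_closedE (A : set (projspace V)) : closed A = zariski_closed A.
Proof. by rewrite -openC -[A in RHS]setCK. Qed.

End Zariski.

Section ReducibleForms.
Variables (K : fieldType) (r d : nat).

(* dhomog r.+1 K d is the space of forms of degree d in r + 1 variables.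
   For k > d the set is empty, since the truncated d - k makes the degrees
   inconsistent. *)
Definition reducible_split (k : nat) : set (projspace (dhomog r.+1 K d)) :=
  [set P | exists (F : dhomog r.+1 K d)
                  (F1 : dhomog r.+1 K (d - k)) (F2 : dhomog r.+1 K k),
     [/\ val P = <[F]>%VS, val F = val F1 * val F2, F1 != 0 & F2 != 0]].

Definition reducible_forms : set (projspace (dhomog r.+1 K d)) :=
  \bigcup_(k in [set k | (1 <= k <= d./2)%N]) reducible_split k.

End ReducibleForms.

Arguments reducible_split : clear implicits.
Arguments reducible_forms : clear implicits.

(* Main.v *)
From HB Require Import structures.
Require Import Defs.
From mathcomp Require Import all_boot all_order all_algebra.
From mathcomp Require Import boolp classical_sets topology_structure.
From mathcomp Require Import zify ring.
From mathcomp Require Import mpoly.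

(** Forms of degree [d] with a factor of degree [k] are the values of the
    bilinear multiplication map on forms of degrees [d - k] and [k], so both
    bounds are statements about images of a bilinear map [mu : U x W -> V] in
    P(V).

    Upper bound: such an image has dimension at most [dim U + dim W - 2].
    A strict chain of irreducible sets of length [m] comes with forms that
    vanish on one member and not on the next, all of which may be taken of one
    degree [delta]. As the ideals of the members are prime, multiplication by
    such a form is injective modulo the ideal of the larger member and zero modulo
    the ideal of the smaller one; by Pascal's rule this yields 'C(q + m, m)
    forms of degree [delta * q] that are linearly independent on the top member
    ([hilbert_growth]). But a form of degree [e] on [V] pulls back along [mu]
    to a bihomogeneous function of bidegree [(e, e)], and these make up a space
    of dimension 'C(e + a, e) * 'C(e + b, e), where [a + 1] and [b + 1] are the
    dimensions of [U] and [W] ([pullback_dependent]). Comparing the growth in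
    [q] gives [m <= a + b] ([irreducible_chain_bound]). The top of a chain of
    reducible forms is irreducible, hence lies in the closure of the image for
    a single [k], and by convexity of the binomial coefficients
    'C(d - k + r, r) + 'C(k + r, r) is largest for [k = 1] ([bin_split_le]).

    Lower bound: take [k = 1] and let [u] run through a flag of the forms of
    degree [d - 1] with the linear factor a multiple of [x_0], then, with [u]
    arbitrary, let the linear factor run through the flag of the spans of
    [x_0, ..., x_j]. The images are irreducible because two of their points are
    joined by a polynomial curve inside them
    ([irreducible_bilinear_image]). Consecutive ones are separated by linear
    functionals: a coordinate of the quotient by [x_0], then evaluation at a
    coordinate point. The traces of their closures form the chain
    ([long_chain]). *)

Set Implicit Arguments.
Unset Strict Implicit.
Unset Printing Implicit Defensive.

Import GRing.Theory.

Local Open Scope classical_set_scope.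
Local Open Scope ring_scope.

(** * Irreducible sets *)

Section IrreducibleSets.
Variable T : topologicalType.
Implicit Types Z : set T.

(** A dense irreducible subset suffices: this is how the relatively closed
    members of a chain inherit irreducibility from parametrized sets. *)
Lemma irreducible_closure_between Z (Y : set T) :
  irreducible_set Z -> Z `<=` Y -> Y `<=` closure Z -> irreducible_set Y.
Proof.
move=> [[x Zx] irrZ] ZY YZ; split; first by exists x; exact: ZY.
have sub C : closed C -> Z `<=` C -> Y `<=` C.
  by move=> cC ZC y /YZ Zy; exact/cC/(closureS ZC).
move=> C1 C2 c1 c2 YC.
by case: (irrZ C1 C2 c1 c2 (subset_trans ZY YC)) => /sub; [left|right]; auto.
Qed.

Lemma irreducible_sub_bigcup Z (C : nat -> set T) (n : nat) :
  irreducible_set Z -> (forall i, closed (C i)) ->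
  Z `<=` \bigcup_(i in [set i | (i < n)%N]) C i ->
  exists2 i, (i < n)%N & Z `<=` C i.
Proof.
move=> [[x Zx] irrZ] cC; elim: n => [|n IHn] ZC.
  by have [i] := ZC x Zx.
have cU : closed (\bigcup_(i in [set i | (i < n)%N]) C i).
  elim: n {IHn ZC} => [|n IHn].
    have -> : \bigcup_(i in [set i | (i < 0)%N]) C i = set0.
      by apply/seteqP; split=> y // [].
    exact: closed0.
  have -> : \bigcup_(i in [set i | (i < n.+1)%N]) C i =
            \bigcup_(i in [set i | (i < n)%N]) C i `|` C n; last exact: closedU.
  apply/seteqP; split=> y.
    by move=> [i /=]; rewrite ltnS leq_eqVlt => /predU1P[->|]; [right|left; exists i].
  by move=> [[i /= ltin Ci]|Cn]; [exists i => //=; exact: ltnW|exists n => /=].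
have ZU : Z `<=` \bigcup_(i in [set i | (i < n)%N]) C i `|` C n.
  move=> y /ZC[i /=]; rewrite ltnS leq_eqVlt => /predU1P[->|]; first by right.
  by left; exists i.
case: (irrZ _ _ cU (cC n) ZU) => [/IHn[i ltin ZCi]|ZCn]; last by exists n.
by exists i => //; exact: ltnW.
Qed.

End IrreducibleSets.

(** * Vanishing of homogeneous forms *)

Section Vanishing.
Variables (K : fieldType) (V : vectType K).
Implicit Types (f g : {mpoly K[\dim {:V}]}) (P : projspace V)
  (C : set (projspace V)).

Definition vanishes_on f C := forall P, C P -> vanishes_at f P.

Lemma projspace_of (v : V) : v != 0 -> exists P : projspace V, val P = <[v]>%VS.
Proof.
move=> nz; have dv : \dim <[v]> == 1%N by rewrite dim_vline nz.
by exists (exist _ <[v]>%VS dv).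
Qed.

Lemma vanishes_atM d e f g P : f \is d.-homog -> g \is e.-homog ->
  vanishes_at (f * g) P -> vanishes_at f P \/ vanishes_at g P.
Proof.
move=> fd ge; have [u _ Pu] := projspaceP P.
move/(vanishes_at_line (dhomogM fd ge) Pu)/eqP; rewrite mevalM mulf_eq0.
by case/orP=> /eqP ?; [left; apply/(vanishes_at_line fd Pu)
  |right; apply/(vanishes_at_line ge Pu)].
Qed.

Lemma vanishes_onMl f g C : vanishes_on f C -> vanishes_on (f * g) C.
Proof. by move=> fC P CP v Pv; rewrite mevalM (fC P CP v Pv) mul0r. Qed.

Lemma closed_vanishing e f : f \is e.-homog ->
  closed [set P : projspace V | vanishes_at f P].
Proof.
move=> fe; rewrite projspace_closedE; exists [set f].
  by move=> _ ->; exists e.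
by apply/seteqP; split=> [P fP _ ->|P]; [|apply].
Qed.

Lemma vanishes_on_closure e f C : f \is e.-homog ->
  vanishes_on f C -> vanishes_on f (closure C).
Proof. by move=> fe fC P CP; exact/(closed_vanishing fe)/(closureS fC). Qed.

(** The ideal of an irreducible set is prime. *)
Lemma irreducible_vanishing_prime C d e f g : irreducible_set C ->
  f \is d.-homog -> g \is e.-homog ->
  vanishes_on (f * g) C -> vanishes_on f C \/ vanishes_on g C.
Proof.
move=> [_ irrC] fd ge fgC.
by apply: (irrC _ _ (closed_vanishing fd) (closed_vanishing ge)) => P /fgC;
  exact: (vanishes_atM fd ge).
Qed.

Lemma coords_inj0 (v : V) : (forall i, coords v i = 0) -> v = 0.
Proof.
move=> v0; rewrite [v](coord_vbasis (memvf v)).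
by rewrite big1 // => i _; rewrite -/(coords v i) v0 scale0r.
Qed.

Lemma homog_X n i : ('X_i : {mpoly K[n]}) \is 1.-homog.
Proof. by rewrite dhomogX /= mdeg1. Qed.

Lemma exists_nonvanishing_coord C : C !=set0 ->
  exists i, ~ vanishes_on ('X_i) C.
Proof.
move=> [P CP]; have [u /eqP nzu Pu] := projspaceP P.
apply: contra_notP nzu => /forallNP vanX; apply: coords_inj0 => i.
have /contrapT/(_ P CP)/(vanishes_at_line (homog_X i) Pu) := vanX i.
by rewrite mevalXU.
Qed.

(** Multiplying by a power of a coordinate raises the degree of a separating
    form, so that one degree serves for a whole chain. *)
Lemma separate_degree C C' e f : irreducible_set C' -> f \is e.-homog ->
    vanishes_on f C -> ~ vanishes_on f C' ->
  forall d, (e <= d)%N ->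
    exists g, [/\ g \is d.-homog, vanishes_on g C & ~ vanishes_on g C'].
Proof.
move=> irrC' fe fC fC' d led; have [i Xi] := exists_nonvanishing_coord irrC'.1.
have Xk k : ('X_i ^+ k : {mpoly K[\dim {:V}]}) \is k.-homog.
  by have := dhomogMn k (homog_X i); rewrite mul1n.
exists (f * 'X_i ^+ (d - e)); split.
- by have := dhomogM fe (Xk (d - e)%N); rewrite subnKC.
- exact: vanishes_onMl.
elim: (d - e)%N => [|k IHk]; first by rewrite expr0 mulr1.
by rewrite exprSr mulrA; case/(irreducible_vanishing_prime irrC' (dhomogM fe (Xk k)) (homog_X i)).
Qed.

(** * Growth of the Hilbert function along a chain *)

(** The Hilbert function of [C] in degree [e] is at least [t]; families of forms
    avoid the quotient by the ideal of [C]. *)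
Definition has_indep C (e t : nat) :=
  exists F : 'I_t -> {mpoly K[\dim {:V}]}, (forall i, F i \is e.-homog) /\
    forall c : 'I_t -> K, vanishes_on (\sum_i c i *: F i) C -> forall i, c i = 0.

Lemma has_indep1 C e f : f \is e.-homog -> ~ vanishes_on f C ->
  has_indep C e 1.
Proof.
move=> fe fC; exists (fun=> f); split=> // c; rewrite big_ord1 => cfC i.
rewrite ord1; apply/eqP; apply: contra_notT fC => nzc P CP v Pv.
have /eqP := cfC P CP v Pv; rewrite mevalZ mulf_eq0 (negbTE nzc) /=.
by move/eqP.
Qed.

Lemma dhomog_lincomb n t (c : 'I_t -> K) (F : 'I_t -> {mpoly K[n]}) e :
  (forall i, F i \is e.-homog) -> \sum_i c i *: F i \is e.-homog.
Proof. by move=> hF; apply: rpred_sum => i _; apply: rpredZ. Qed.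

(** In the quotient by the prime ideal of [C], multiplication by [f] is
    injective, and its image dies on [C']; hence a relation on [C] restricts to
    a relation among the forms independent on [C'], and what remains can be
    divided by [f]. *)
Lemma has_indep_add C C' d e f t1 t2 : irreducible_set C -> C' `<=` C ->
    f \is d.-homog -> vanishes_on f C' -> ~ vanishes_on f C ->
    has_indep C e t1 -> has_indep C' (d + e) t2 ->
  has_indep C (d + e) (t1 + t2).
Proof.
move=> irrC C'C fd fC' fC [F [Fe indF]] [G [Ge indG]].
exists (fun i => match split i with inl j => f * F j | inr k => G k end).
split=> [i|c]; first by case: (split i) => j //; exact: dhomogM.
rewrite big_split_ord /=.
rewrite (eq_bigr (fun i => f * (c (lshift t2 i) *: F i))); last first.
  by move=> i _; rewrite -[lshift _ _]/(unsplit (inl i)) unsplitK scalerAr.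
rewrite [X in _ + X](eq_bigr (fun i => c (rshift t1 i) *: G i)); last first.
  by move=> i _; rewrite -[rshift _ _]/(unsplit (inr i)) unsplitK.
rewrite -mulr_sumr; set p := \sum_i _; set q := \sum_i _ => fpqC.
have c2 : forall k, c (rshift t1 k) = 0.
  apply: (indG (fun k => c (rshift t1 k))) => P C'P v Pv.
  by have := fpqC P (C'C P C'P) v Pv; rewrite mevalD mevalM (fC' P C'P v Pv) mul0r add0r.
have q0 : q = 0 by rewrite /q big1 // => k _; rewrite c2 scale0r.
have c1 : forall j, c (lshift t2 j) = 0.
  apply: (indF (fun j => c (lshift t2 j))); rewrite -/p.
  move: fpqC; rewrite q0 addr0.
  by case/(irreducible_vanishing_prime irrC fd (dhomog_lincomb _ Fe)).
by move=> i; rewrite -[i]splitK; case: (split i).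
Qed.

(** The bound is the Hilbert function of P^m: the chain behaves like a flag of
    linear subspaces, and Pascal's rule for 'C(q + m, m) is the inequality of
    [has_indep_add]. *)
Lemma hilbert_growth d m (c : nat -> set (projspace V)) :
    (forall i, (i <= m)%N -> irreducible_set (c i)) ->
    (forall i, (i < m)%N -> c i `<=` c i.+1) ->
    (exists2 f, f \is d.-homog & ~ vanishes_on f (c 0%N)) ->
    (forall i, (i < m)%N -> exists f,
      [/\ f \is d.-homog, vanishes_on f (c i) & ~ vanishes_on f (c i.+1)]) ->
  forall q, has_indep (c m) (d * q) 'C(q + m, m).
Proof.
have not1 C : C !=set0 -> ~ vanishes_on 1 C.
  move=> [P CP] /(_ P CP); have [u _ Pu] := projspaceP P.
  by move/(vanishes_at_line (dhomog1 _ _) Pu)/eqP; rewrite meval1 oner_eq0.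
move=> irr sub [f0 f0d f0C]; elim: m irr sub => [|m IHm] irr sub sep q.
  rewrite bin0; apply: (has_indep1 (f := f0 ^+ q)); first exact: dhomogMn.
  elim: q => [|q IHq]; first by rewrite expr0; exact/not1/(irr 0%N isT).1.
  by rewrite exprS; case/(irreducible_vanishing_prime (irr 0%N isT) f0d (dhomogMn _ f0d)).
elim: q => [|q IHq].
  rewrite add0n binn muln0; apply: (@has_indep1 _ _ 1); first exact: dhomog1.
  exact/not1/(irr m.+1 (leqnn _)).1.
have [f [fd fC' fC]] := sep m (ltnSn m).
rewrite addSnnS addnS binS mulnS.
apply: has_indep_add fd fC' fC IHq _; [exact: irr|exact: sub|].
rewrite -mulnS -addSnnS; apply: IHm => i ltim.
- by apply: irr; exact: leqW.
- by apply: sub; exact: ltnW.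
- by apply: sep; exact: leqW.
Qed.

End Vanishing.

(** * Forms pulled back along a bilinear map *)

Section Forms.
Variable K : fieldType.

Lemma linear_form (V : vectType K) (phi : {scalar V}) :
  exists2 f : {mpoly K[\dim {:V}]}, f \is 1.-homog &
    forall v, f.@[coords v] = phi v.
Proof.
exists (\sum_(i < \dim {:V}) phi (vbasis {:V})`_i *: 'X_i).
  by apply: rpred_sum => i _; exact/rpredZ/homog_X.
move=> v; rewrite [in RHS](coord_vbasis (memvf v)) !raddf_sum /=.
by apply: eq_bigr => i _; rewrite mevalZ mevalXU mulrC linearZ.
Qed.

Lemma dim_dhomog n e : \dim {:dhomog n.+1 K e} = 'C(e + n, e).
Proof. by rewrite dimvf. Qed.

Lemma forms_span n e : (0 < n)%N ->
  exists x : ('I_n -> K) -> 'rV[K]_('C(e + n.-1, e)),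
    forall f : {mpoly K[n]}, f \is e.-homog ->
    exists c : 'cV[K]_('C(e + n.-1, e)), forall v, f.@[v] = (x v *m c) 0 0.
Proof.
case: n => // n _ /=; rewrite -dim_dhomog.
pose b := vbasis {:dhomog n.+1 K e}.
exists (fun v => \row_i (val b`_i).@[v]) => f fe.
exists (\col_i coord b i (DHomog fe)) => v.
have := congr1 val (coord_vbasis (memvf (DHomog fe))); rewrite /= -/b => {1}->.
rewrite mxE !raddf_sum /=; apply: eq_bigr => i _.
by rewrite !mxE mevalZ mulrC.
Qed.

End Forms.

Section Bihomogeneous.
Variables (K : fieldType) (U W : vectType K).

(** The part of bidegree [(e, e)] of the coordinate ring of P(U) x P(W), as
    functions on [U x W]. *)
Definition bihomogeneous e (h : U -> W -> K) :=
  exists s : seq ({mpoly K[\dim {:U}]} * {mpoly K[\dim {:W}]}),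
    (forall pq, pq \in s -> pq.1 \is e.-homog /\ pq.2 \is e.-homog) /\
    (forall u w, h u w = \sum_(pq <- s) pq.1.@[coords u] * pq.2.@[coords w]).

Lemma bihomogeneous_sum e (I : Type) (r : seq I) (h : I -> U -> W -> K) :
  (forall i, bihomogeneous e (h i)) ->
  bihomogeneous e (fun u w => \sum_(i <- r) h i u w).
Proof.
move=> hh; elim: r => [|i r [s [s_e sE]]].
  by exists [::]; split=> // u w; rewrite !big_nil.
have [s' [s'_e s'E]] := hh i; exists (s' ++ s); split.
  by move=> pq; rewrite mem_cat => /orP[/s'_e|/s_e].
by move=> u w; rewrite big_cons big_cat s'E sE.
Qed.

Lemma bihomogeneousM d e h g : bihomogeneous d h -> bihomogeneous e g ->
  bihomogeneous (d + e) (fun u w => h u w * g u w).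
Proof.
move=> [s [s_d sE]] [t [t_e tE]].
exists [seq (p.1 * q.1, p.2 * q.2) | p <- s, q <- t]; split.
  move=> pq /allpairsP[[p q] [/s_d[p1 p2] /t_e[q1 q2] ->]] /=.
  by split; apply: dhomogM.
move=> u w; rewrite sE tE big_allpairs_dep mulr_suml; apply: eq_bigr => p _.
by rewrite mulr_sumr; apply: eq_bigr => q _; rewrite !mevalM mulrACA.
Qed.

Lemma bihomogeneousC a : bihomogeneous 0 (fun _ _ => a).
Proof.
exists [:: (a%:MP, 1)]; split=> [pq|u w].
  rewrite inE => /eqP -> /=; split; last exact: dhomog1.
  by rewrite -[a%:MP]mulr1 mul_mpolyC; apply/rpredZ/dhomog1.
by rewrite big_seq1 mevalC meval1 mulr1.
Qed.

Lemma bihomogeneousX d k h : bihomogeneous d h ->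
  bihomogeneous (k * d) (fun u w => h u w ^+ k).
Proof.
move=> hd; elim: k => [|k IHk]; first exact: bihomogeneousC.
rewrite mulSn (_ : (fun u w => _) = fun u w => h u w * h u w ^+ k).
  exact: bihomogeneousM.
by apply: funext => u; apply: funext => w; rewrite exprS.
Qed.

Lemma bihomogeneous_prod (I : Type) (r : seq I) (d : I -> nat)
    (h : I -> U -> W -> K) : (forall i, bihomogeneous (d i) (h i)) ->
  bihomogeneous (\sum_(i <- r) d i) (fun u w => \prod_(i <- r) h i u w).
Proof.
move=> hh; elim: r => [|i r IHr].
  rewrite big_nil (_ : (fun u w => _) = fun u w => 1); first exact: bihomogeneousC.
  by apply: funext => u; apply: funext => w; rewrite big_nil.
rewrite big_cons.
rewrite (_ : (fun u w => _) = fun u w => h i u w * \prod_(i <- r) h i u w).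
  exact: bihomogeneousM.
by apply: funext => u; apply: funext => w; rewrite big_cons.
Qed.

(** Writing the functions as matrices bounds the dimension of their space by the
    number of entries of [c]. *)
Lemma bihomogeneous_span e : (0 < \dim {:U})%N -> (0 < \dim {:W})%N ->
  exists (x : U -> 'rV[K]_('C(e + (\dim {:U}).-1, e)))
         (y : W -> 'cV[K]_('C(e + (\dim {:W}).-1, e))),
    forall h, bihomogeneous e h ->
    exists c, forall u w, h u w = (x u *m c *m y w) 0 0.
Proof.
move=> dU dW; have [x xP] := forms_span K e dU; have [y yP] := forms_span K e dW.
exists (fun u => x (coords u)), (fun w => (y (coords w))^T) => h [s [s_e sE]].
have [c cE] : exists c, forall u w,
    \sum_(pq <- s) pq.1.@[coords u] * pq.2.@[coords w] =
    (x (coords u) *m c *m (y (coords w))^T) 0 0.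
  elim: s s_e {h sE} => [|[p q] s IHs] s_e.
    by exists 0 => u w; rewrite big_nil mulmx0 mul0mx mxE.
  have /= [/xP[a pE] /yP[b qE]] := s_e (p, q) (mem_head _ _).
  have [|c cE] := IHs; first by move=> pq sq; apply: s_e; rewrite inE sq orbT.
  exists (a *m b^T + c) => u w.
  have ab : p.@[coords u] * q.@[coords w] =
      (x (coords u) *m (a *m b^T) *m (y (coords w))^T) 0 0.
    rewrite pE qE !mulmxA -(mulmxA _ b^T) -trmx_mul.
    by rewrite [RHS]mxE big_ord1 [X in _ = _ * X]mxE.
  rewrite big_cons cE /= ab mulmxDr mulmxDl.
  by rewrite [RHS]mxE.
by exists c => u w; rewrite sE cE.
Qed.

End Bihomogeneous.

Section Pullback.
Variables (K : fieldType) (U W V : vectType K) (mu : {bilinear U -> W -> V}).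

Lemma bihomogeneous_coord i : bihomogeneous 1 (fun u w => coords (mu u w) i).
Proof.
have psiP p : exists f : {mpoly K[\dim {:W}]}, f \is 1.-homog /\
    forall w, f.@[coords w] = coords (mu (vbasis {:U})`_p w) i.
  pose phi0 w : K := coords (mu (vbasis {:U})`_p w) i.
  have lin : scalar phi0.
    by move=> a w w'; rewrite /phi0 linearPr /coords linearP.
  pose phi : {scalar W} := HB.pack phi0 (GRing.isLinear.Build _ _ _ _ _ lin).
  by have [f f1 fE] := linear_form phi; exists f.
have [psi psiE] := choice psiP.
exists [seq ('X_p, psi p) | p : 'I_(\dim {:U}) <- enum 'I_(\dim {:U})]; split.
  by move=> _ /mapP[p _ ->] /=; split; [exact: homog_X|have [] := psiE p].
move=> u w; rewrite big_map big_enum /= [in LHS](coord_vbasis (memvf u)).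
rewrite linear_sumlz /coords linear_sum; apply: eq_bigr => p _ /=.
by rewrite linearZl_LR linearZ /= mevalXU; have [_ ->] := psiE p.
Qed.

Lemma bihomogeneous_pullback e (f : {mpoly K[\dim {:V}]}) : f \is e.-homog ->
  bihomogeneous e (fun u w => f.@[coords (mu u w)]).
Proof.
move=> fe; rewrite (_ : (fun u w => _) = fun u w => \sum_(m <- msupp f)
    (if m \in msupp f then f@_m * \prod_i coords (mu u w) i ^+ m i else 0)).
  apply: bihomogeneous_sum => m; have [mf|_] := boolP (m \in msupp f); last first.
    by exists [::]; split=> // u w; rewrite big_nil.
  rewrite -[e]add0n; apply: bihomogeneousM; first exact: bihomogeneousC.
  rewrite -(dhomogP _ _ _ fe m mf) /= mdegE; apply: bihomogeneous_prod => i.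
  by rewrite -[X in bihomogeneous X]muln1; exact/bihomogeneousX/bihomogeneous_coord.
apply: funext => u; apply: funext => w; rewrite mevalE.
by rewrite big_seq [RHS]big_seq; apply: eq_bigr => m ->.
Qed.

(** More matrices than they have entries are linearly dependent, and the relation
    carries over to the functions that they represent. *)
Lemma pullback_dependent e t (F : 'I_t -> {mpoly K[\dim {:V}]}) :
    (0 < \dim {:U})%N -> (0 < \dim {:W})%N -> (forall i, F i \is e.-homog) ->
    ('C(e + (\dim {:U}).-1, e) * 'C(e + (\dim {:W}).-1, e) < t)%N ->
  exists2 c : 'I_t -> K, exists i, c i != 0 &
    forall u w, (\sum_i c i *: F i).@[coords (mu u w)] = 0.
Proof.
move=> dU dW Fe; set A := 'C(_, _); set B := 'C(_, _) => ltABt.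
have [x [y xyP]] := bihomogeneous_span e dU dW.
have [C CE] := choice (fun i => xyP _ (bihomogeneous_pullback (Fe i))).
pose M := \matrix_i mxvec (C i).
have : kermx M != 0.
  by rewrite kermx_eq0 -row_leq_rank -ltnNge (leq_ltn_trans (rank_leq_col M)).
case/rowV0Pn=> v /sub_kermxP vM /rV0Pn[i nzi].
exists (v 0); first by exists i.
have CM : \sum_i v 0 i *: C i = 0.
  apply: (can_inj mxvecK); rewrite linear0 -vM mulmx_sum_row linear_sum /=.
  by apply: eq_bigr => j _; rewrite linearZ rowK.
move=> u w; rewrite raddf_sum /=.
transitivity ((x u *m (\sum_i v 0 i *: C i) *m y w) 0 0).
  rewrite mulmx_sumr mulmx_suml summxE; apply: eq_bigr => j _.
  by rewrite mevalZ CE -scalemxAr -scalemxAl [RHS]mxE.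
by rewrite CM mulmx0 mul0mx !mxE.
Qed.

End Pullback.

(** * Estimates for binomial coefficients *)

Lemma bin_le_exp n k : ('C(n + k, n) <= n.+1 ^ k)%N.
Proof.
rewrite -bin_sub ?leq_addr // addKn; elim: k => [|k IHk]; first by rewrite bin0.
rewrite addnS -(leq_pmul2l (ltn0Sn k)) -mul_bin_diag /= expnS mulnA.
by apply: leq_mul => //; nia.
Qed.

Lemma exp_le_fact_bin q m : (q.+1 ^ m <= m`! * 'C(q + m, m))%N.
Proof.
elim: m => [|m IHm]; first by rewrite bin0.
rewrite expnS factS mulnAC addnS -mul_bin_diag /= mulnAC -mulnA.
by apply: leq_mul; [rewrite ltnS leq_addr|].
Qed.

(** The left side is at least [q.+1 ^ m / m`!] and the right side at most
    [d ^ (a + b) * q.+1 ^ (a + b)], which excludes [a + b < m] for large [q]. *)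
Lemma growth_exponent_le d m a b : (0 < d)%N ->
  (forall q, 'C(q + m, m) <= 'C(d * q + a, d * q) * 'C(d * q + b, d * q))%N ->
  (m <= a + b)%N.
Proof.
move=> d0 le_bin; rewrite leqNgt; apply/negP => ltabm.
pose q := (m`! * d ^ (a + b))%N; suff : (q.+1 <= q)%N by rewrite ltnn.
have q0 : (0 < q.+1 ^ (a + b))%N by rewrite expn_gt0.
rewrite -(leq_pmul2r q0) -expnS.
apply: (@leq_trans (q.+1 ^ m)); first by rewrite leq_exp2l ?ltnS // muln_gt0 fact_gt0 expn_gt0 d0.
apply: leq_trans (exp_le_fact_bin q m) _; rewrite -mulnA leq_mul2l -expnMn.
apply/orP; right; apply: leq_trans (le_bin q) _.
apply: leq_trans (leq_mul (bin_le_exp _ _) (bin_le_exp _ _)) _.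
rewrite -expnD; have [->|ab0] := posnP (a + b); first by rewrite !expn0.
by rewrite leq_exp2r //; nia.
Qed.

(** The increments of ['C(x + r, r)] in [x] are ['C(x + r, r.-1)], which is
    monotone. *)
Lemma bin_convex r x s : (0 < r)%N ->
  ('C(x + s.+1 + r, r) + 'C(x.+1 + r, r) <= 'C(x + s.+2 + r, r) + 'C(x + r, r))%N.
Proof.
case: r => // r _.
have pascal y : 'C(y.+1 + r.+1, r.+1) = ('C(y + r.+1, r.+1) + 'C(y + r.+1, r))%N.
  by rewrite addSn binS.
have : ('C(x + r.+1, r) <= 'C(x + s.+1 + r.+1, r))%N by apply: leq_bin2l; lia.
by rewrite (addnS x s.+1) (pascal x) (pascal (x + s.+1)%N); lia.
Qed.

(** By convexity the left side does not increase with [k] up to [d./2]. *)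
Lemma bin_split_le r d k : (0 < r)%N -> (0 < k <= d./2)%N ->
  ('C(d - k + r, r) + 'C(k + r, r) <= 'C(d.-1 + r, r) + r.+1)%N.
Proof.
move=> r0; elim: k => // -[|k] IHk /andP[_ lek].
  by rewrite subn1 add1n binSn.
apply: leq_trans (IHk _); last by rewrite /= ltnW.
have lekd : (k.+2 <= d - k.+2)%N by have := leq_half_double k.+2 d; lia.
have [s ->] : exists s, d = (k.+1 + k.+1 + s.+2)%N by exists (d - (k.+1 + k.+1 + 2))%N; lia.
have := @bin_convex r k.+1 s r0.
by congr (_ + _ <= _ + _)%N; congr 'C(_, _); lia.
Qed.

(** * The image of a bilinear map in projective space *)

Definition bilinear_image (K : fieldType) (U W V : vectType K)
    (mu : U -> W -> V) (L : set U) (M : set W) : set (projspace V) :=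
  [set P | exists u w, [/\ L u, M w & val P = <[mu u w]>%VS]].

Section ChainBound.
Variables (K : fieldType) (U W V : vectType K) (mu : {bilinear U -> W -> V}).

Lemma chain_separators (A : set (projspace V)) m c : irreducible_chain A m c ->
  exists d0, forall d, (d0 <= d)%N -> forall i, (i < m)%N -> exists f,
    [/\ f \is d.-homog, vanishes_on f (c i) & ~ vanishes_on f (c i.+1)].
Proof.
move=> [cA cS].
have sep i : (i < m)%N -> exists d0, forall d, (d0 <= d)%N -> exists f,
    [/\ f \is d.-homog, vanishes_on f (c i) & ~ vanishes_on f (c i.+1)].
  move=> ltim; have [_ /existsNP[P /not_implyP[cP ncP]]] := cS i ltim.
  have [D + cE] := (cA i (ltnW ltim)).1.
  rewrite projspace_closedE => -[E hE DE]; rewrite {}DE in cE.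
  have [[D' _ cE'] irrS] := cA i.+1 ltim.
  have : ~ zero_locus E P by move=> EP; apply: ncP; rewrite cE; split=> //;
    move: cP; rewrite cE' => -[].
  move/existsNP=> [f /not_implyP[Ef nfP]]; have [e fe] := hE f Ef.
  exists e => d led; apply: (separate_degree irrS fe) led.
    by move=> Q; rewrite cE => -[_ /(_ f Ef)].
  by move=> /(_ P cP).
elim: m {cA cS} sep => [|m IHm] sep; first by exists 0%N.
have [i ltim|d1 d1P] := IHm; first by apply: sep; exact: leqW.
have [d2 d2P] := sep m (ltnSn m).
exists (maxn d1 d2) => d; rewrite geq_max => /andP[le1 le2] i.
by rewrite ltnS leq_eqVlt => /predU1P[->|]; [exact: d2P|exact: d1P].
Qed.

(** Forms vanishing on the image vanish on its closure, so that the many forms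
    independent on the top of the chain pull back to independent bihomogeneous
    functions. *)
Lemma irreducible_chain_bound (A : set (projspace V)) m c :
    (0 < \dim {:U})%N -> (0 < \dim {:W})%N -> irreducible_chain A m c ->
    c m `<=` closure (bilinear_image mu setT setT) ->
  (m <= (\dim {:U}).-1 + (\dim {:W}).-1)%N.
Proof.
move=> dU dW chain cl; have [d0 sep] := chain_separators chain.
have [cA cS] := chain; pose d := d0.+1.
have irr i : (i <= m)%N -> irreducible_set (c i) by move=> /cA[].
have [j nXj] := exists_nonvanishing_coord (irr 0%N isT).1.
(* A power of a coordinate: a form separating the bottom from the empty set. *)
have [f [fd _ fc]] := separate_degree (irr 0%N isT) (homog_X _ j)
  (fun P (P0 : set0 P) => False_ind _ P0) nXj (ltn0Sn d0).
have growth : forall q, has_indep (c m) (d * q) 'C(q + m, m).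
  apply: hilbert_growth => //; first by move=> i /cS[].
    by exists f.
  by apply: sep; exact: leqnSn.
apply: (@growth_exponent_le d) => // q; rewrite leqNgt; apply/negP => lt_indep.
have [F [Fe indF]] := growth q.
have [a [i nzai] aF] := pullback_dependent mu dU dW Fe lt_indep.
case/eqP: nzai; apply: indF => P /cl.
apply: (vanishes_on_closure (dhomog_lincomb a Fe)) => Q [u [w [_ _ Qp]]].
exact/(vanishes_at_line (dhomog_lincomb a Fe) Qp).
Qed.

End ChainBound.

Section IrreducibleImage.
Variables (K : closedFieldType) (U W V : vectType K).
Variable mu : {bilinear U -> W -> V}.

Lemma line_restriction (f : {mpoly K[\dim {:V}]}) u u' w w' :
  exists p : {poly K}, forall t,
    p.[t] = f.@[coords (mu (u + t *: u') (w + t *: w'))].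
Proof.
pose x i : {poly K} := (coords (mu u w) i)%:P
  + (coords (mu u w') i + coords (mu u' w) i)%:P * 'X
  + (coords (mu u' w') i)%:P * 'X^2.
exists (mmap polyC x f) => t; rewrite mevalE /mmap horner_sum.
apply: eq_bigr => m _; rewrite hornerM hornerC horner_prod; congr (_ * _).
apply: eq_bigr => i _; rewrite horner_exp; congr (_ ^+ _).
rewrite !hornerE /= linearDl !linearDr !linearZl_LR !linearZr_LR /coords /=.
rewrite !linearD !linearZ /=; set A := coord _ _ _; set B := coord _ _ _.
set C := coord _ _ _; set D := coord _ _ _.
by ring.
Qed.

(** If two closed sets each miss a point of the image, then on the segment in
    [U x W] joining preimages of these points an equation of either set becomes a
    non-zero polynomial in one variable; over the infinite field [K] the two
    polynomials have a common non-root, so the two sets do not cover the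
    image. *)
Lemma irreducible_bilinear_image (L : set U) (M : set W) :
    (forall a u v, L u -> L v -> L (a *: u + v)) ->
    (forall a w v, M w -> M v -> M (a *: w + v)) ->
    bilinear_image mu L M !=set0 ->
  irreducible_set (bilinear_image mu L M).
Proof.
move=> linL linM ne; split=> // C1 C2 + + sub.
rewrite !projspace_closedE => -[E1 hE1 C1E] [E2 hE2 C2E].
apply: contrapT => /not_orP[/existsNP[P1 /not_implyP[im1 n1]]
                            /existsNP[P2 /not_implyP[im2 n2]]].
move: n1 n2 sub; rewrite {}C1E {}C2E.
move=> /existsNP[f1 /not_implyP[Ef1 nf1]] /existsNP[f2 /not_implyP[Ef2 nf2]] sub.
have [[e1 fe1] [e2 fe2]] := (hE1 _ Ef1, hE2 _ Ef2).
have [u1 [w1 [Lu1 Mw1 PE1]]] := im1; have [u2 [w2 [Lu2 Mw2 PE2]]] := im2.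
have nz1 : mu u1 w1 != 0.
  by have /eqP := valP P1; rewrite PE1 dim_vline; case: eqP.
have [j nzj] : exists j, coords (mu u1 w1) j != 0.
  apply: contrapT => /forallNP v0; case/eqP: nz1; apply: coords_inj0 => j.
  by apply/eqP/negPn/negP/v0.
have line f := line_restriction f u1 (u2 - u1) w1 (w2 - w1).
have [[p1 p1E] [p2 p2E] [p3 p3E]] := And3 (line f1) (line f2) (line 'X_j).
(* [p3] keeps [mu] away from 0, so that the value on the segment has a class in
   P(V). *)
have : p1 * p2 * p3 != 0.
  rewrite !mulf_neq0 //; apply/eqP => p0.
  - apply: nf1; apply/(vanishes_at_line fe1 PE1).
    by have := p1E 0; rewrite p0 !scale0r !addr0 horner0.
  - apply: nf2; apply/(vanishes_at_line fe2 PE2).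
    by have := p2E 1; rewrite p0 !scale1r ![_ + (_ - _)]addrC !subrK horner0.
  - have := p3E 0; rewrite p0 !scale0r !addr0 horner0 mevalXU => /esym/eqP.
    by rewrite (negbTE nzj).
case/closed_nonrootP => t; rewrite !rootM !negb_or -andbA => /and3P[].
rewrite /root p1E p2E p3E mevalXU; set u := u1 + _; set w := w1 + _.
move=> nz_f1 nz_f2 nz_v.
have nz : mu u w != 0.
  by apply: contra_neq nz_v => ->; rewrite /coords linear0.
have [P PE] := projspace_of nz.
have Lu : L u.
  have -> : u = t *: (- 1 *: u1 + u2) + u1 by rewrite scaleN1r [RHS]addrC (addrC (- u1)).
  exact: linL _ _ _ (linL _ _ _ Lu1 Lu2) Lu1.
have Mw : M w.
  have -> : w = t *: (- 1 *: w1 + w2) + w1 by rewrite scaleN1r [RHS]addrC (addrC (- w1)).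
  exact: linM _ _ _ (linM _ _ _ Mw1 Mw2) Mw1.
have [/(_ f1 Ef1)|/(_ f2 Ef2)] := sub P (ex_intro _ u (ex_intro _ w (And3 Lu Mw PE))).
  by move/(vanishes_at_line fe1 PE)/eqP; rewrite (negbTE nz_f1).
by move/(vanishes_at_line fe2 PE)/eqP; rewrite (negbTE nz_f2).
Qed.

End IrreducibleImage.

(** A form separating two sets separates their closures, hence also the traces
    of these closures on [A]. *)
Lemma irreducible_chain_closures (K : fieldType) (V : vectType K)
    (A : set (projspace V)) m (Z : nat -> set (projspace V)) :
    (forall i, (i <= m)%N -> Z i `<=` A /\ irreducible_set (Z i)) ->
    (forall i, (i < m)%N -> Z i `<=` Z i.+1) ->
    (forall i, (i < m)%N -> exists e f,
      [/\ f \is e.-homog, vanishes_on f (Z i) & ~ vanishes_on f (Z i.+1)]) ->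
  irreducible_chain A m (fun i => A `&` closure (Z i)).
Proof.
move=> hZ sub sep; split=> i ltim.
  have [ZA irr] := hZ i ltim; split; first by exists (closure (Z i)) => //; exact: closed_closure.
  apply: irreducible_closure_between irr _ (@subIsetr _ _ _) => P ZP.
  by split; [exact: ZA|exact: subset_closure].
split=> [P [AP cP]|cl]; first by split=> //; exact: closureS (sub i ltim) _ cP.
have [e [f [fe fZ []]]] := sep i ltim.
move=> P ZP; apply: (vanishes_on_closure fe fZ).
have [ZA _] := hZ i.+1 ltim.
by have [] := cl P (conj (ZA P ZP) (subset_closure ZP)).
Qed.

(** * Multiplication of forms *)

Section FormMultiplication.
Variables (K : fieldType) (n e f d : nat) (efd : (e + f = d)%N).

Lemma mul_homog (u : dhomog n K e) (w : dhomog n K f) : val u * val w \is d.-homog.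
Proof. by rewrite -efd; exact: dhomogM (valP u) (valP w). Qed.

Definition form_mul u w : dhomog n K d := DHomog (mul_homog u w).

Lemma form_mul_bilinear : bilinear_for *:%R *:%R form_mul.
Proof.
by split=> [w|u] a x y; apply: val_inj => /=;
  rewrite ?mulrDl ?mulrDr -?scalerAl -?scalerAr.
Qed.

HB.instance Definition _ :=
  bilinear_isBilinear.Build K _ _ _ _ _ form_mul form_mul_bilinear.

Lemma form_mul_eq0 u w : (form_mul u w == 0) = (u == 0) || (w == 0).
Proof.
have valE k (v : dhomog n K k) : (v == 0) = (val v == 0 :> {mpoly K[n]}).
  by rewrite -val_eqE.
by rewrite !valE mulf_eq0.
Qed.

End FormMultiplication.

Lemma reducible_splitE (K : fieldType) r d k (kd : (d - k + k = d)%N) :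
  reducible_split K r d k =
  bilinear_image (form_mul (K := K) (n := r.+1) kd) setT setT.
Proof.
apply/seteqP; split=> P.
  move=> [F [F1 [F2 [PF FE _ _]]]]; exists F1, F2; split=> //.
  by rewrite PF; congr <[_]>%VS; apply: val_inj.
move=> [u [w [_ _ PE]]]; exists (form_mul kd u w), u, w.
have : form_mul kd u w != 0.
  by have /eqP := valP P; rewrite PE dim_vline; case: eqP.
by rewrite form_mul_eq0 negb_or => /andP[].
Qed.

(** * The upper bound *)

(** The irreducible top member lies in the closure of the forms with a factor of
    one fixed degree [k], which is the image of a multiplication map; [k = 1]
    gives the largest bound. *)
Lemma reducible_chain_bound (K : fieldType) r d m A c : (0 < r)%N ->
    A `<=` reducible_forms K r d -> irreducible_chain A m c ->
  (m <= ('C(d.-1 + r, r)).-1 + r)%N.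
Proof.
move=> r0 Asub chain; have [[D _ cmE] irr] := chain.1 m (leqnn m).
have sub : c m `<=` \bigcup_(i in [set i | (i < d./2)%N])
    closure (reducible_split K r d i.+1).
  move=> P; rewrite cmE => -[/Asub[k /= /andP[k0 kd] kP] _].
  by exists k.-1; rewrite /= prednK //; exact: subset_closure.
have [i lti cl] := irreducible_sub_bigcup irr (fun=> @closed_closure _ _) sub.
have le_half : (i.+1 <= d)%N by rewrite (leq_trans lti) // -{2}(odd_double_half d) -addnn; lia.
have splitd : (d - i.+1 + i.+1 = d)%N by rewrite subnK.
move: cl; rewrite (reducible_splitE K r splitd) => cl.
have pos k : (0 < \dim {:dhomog r.+1 K k})%N by rewrite dim_dhomog bin_gt0 leq_addr.
apply: leq_trans (irreducible_chain_bound (pos _) (pos _) chain cl) _.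
have binr k : 'C(k + r, k) = 'C(k + r, r) by rewrite -bin_sub ?leq_addr // addKn.
rewrite !dim_dhomog !binr.
have := @bin_split_le r d i.+1 r0 lti.
have := bin_gt0 (d - i.+1 + r) r; have := bin_gt0 (i.+1 + r) r.
have := bin_gt0 (d.-1 + r) r; rewrite !leq_addl; lia.
Qed.

(** * The chain of maximal length *)

Lemma linear_separator (K : fieldType) (U W V : vectType K) (mu : U -> W -> V)
    (phi : {scalar V}) (L L' : set U) (M M' : set W) u w :
    (forall u' w', L u' -> M w' -> phi (mu u' w') = 0) ->
    L' u -> M' w -> phi (mu u w) != 0 ->
  exists e f, [/\ f \is e.-homog, vanishes_on f (bilinear_image mu L M) &
    ~ vanishes_on f (bilinear_image mu L' M')].
Proof.
move=> phi0 Lu Mw nz; have [f f1 fE] := linear_form phi; exists 1%N, f; split=> //.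
  move=> P [u' [w' [Lu' Mw' PE]]]; apply/(vanishes_at_line f1 PE).
  by rewrite fE phi0.
have nzv : mu u w != 0 by apply: contra_neq nz => ->; rewrite linear0.
have [P PE] := projspace_of nzv.
have imP : bilinear_image mu L' M' P by exists u, w.
move=> /(_ P imP)/(vanishes_at_line f1 PE)/eqP.
by rewrite fE (negbTE nz).
Qed.

Section LongChain.
Variables (K : closedFieldType) (r e d : nat) (e1d : (e + 1 = d)%N).
Let mu := form_mul (K := K) (n := r.+1) e1d.
Let U := dhomog r.+1 K e.
Let N : nat := \dim {:U}.

Definition flag_forms (i : nat) : set U :=
  [set u | forall j : 'I_(\dim {:U}), (i < j)%N -> coords u j = 0].

Definition flag_linear (k : nat) : set (dhomog r.+1 K 1) :=
  [set w | exists c : 'I_r.+1 -> K,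
     val w = \sum_(i < r.+1 | (i <= k)%N) c i *: 'X_i].

(** The truncated subtraction keeps the linear factor in the line of [x_0] until
    the first factor is arbitrary, at [i = N.-1]; only then does it grow. *)
Definition chain_image (i : nat) :=
  bilinear_image mu (flag_forms i) (flag_linear (i - N.-1)).

Definition var (j : 'I_r.+1) : dhomog r.+1 K 1 := DHomog (homog_X K j).

Lemma var_neq0 j : var j != 0.
Proof.
apply/eqP => /(congr1 (fun w => (val w).@[fun=> 1]))/eqP.
by rewrite /= mevalXU meval0 oner_eq0.
Qed.

Lemma flag_linear_var (j : 'I_r.+1) k : (j <= k)%N -> flag_linear k (var j).
Proof.
move=> lejk; exists (fun i => (i == j)%:R) => /=.
rewrite (bigD1 j) //= eqxx scale1r big1 ?addr0 // => i /andP[_ /negbTE ->].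
by rewrite scale0r.
Qed.

Lemma flag_linear0 w : flag_linear 0 w -> exists a, w = a *: var ord0.
Proof.
move=> [c wE]; exists (c ord0); apply: val_inj => /=.
rewrite wE (bigD1 ord0) //= big1 ?addr0 // => i /andP[].
by rewrite leqn0 => /eqP i0 /eqP[]; apply: val_inj.
Qed.

Lemma flag_formsT i u : (N.-1 <= i)%N -> flag_forms i u.
Proof.
by move=> leNi j ltij; move: (ltn_ord j) ltij leNi; rewrite -/N; lia.
Qed.

Lemma chain_image_sub i : chain_image i `<=` chain_image i.+1.
Proof.
move=> P [u [w [Lu [c wE] PE]]]; exists u, w; split=> //.
  by move=> j /ltnW /Lu.
exists (fun j : 'I_r.+1 => if (j <= i - N.-1)%N then c j else 0).
rewrite wE big_mkcond [RHS]big_mkcond; apply: eq_bigr => j _.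
case: ifP => [le1|_]; last by case: ifP => _; rewrite ?scale0r.
by rewrite (leq_trans le1) // leq_sub2r.
Qed.

Lemma coords_vbasis (i j : 'I_N) : coords (vbasis {:U})`_i j = (j == i)%:R.
Proof. by rewrite /coords coord_free ?(basis_free (vbasisP _)) // eq_sym. Qed.

Lemma N_gt0 : (0 < N)%N.
Proof. by rewrite /N dim_dhomog bin_gt0 leq_addr. Qed.

Lemma flag_forms_vbasis (k : 'I_N) i : (k <= i)%N ->
  flag_forms i (vbasis {:U})`_k.
Proof.
move=> leki j ltij; rewrite coords_vbasis.
by case: eqP ltij => // ->; rewrite ltnNge leki.
Qed.

Lemma chain_image_irreducible i : irreducible_set (chain_image i).
Proof.
apply: irreducible_bilinear_image.
- move=> a u v Lu Lv j ltij.
  move: (Lu j ltij) (Lv j ltij); rewrite /coords linearP /= => -> ->.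
  by rewrite mulr0 addr0.
- move=> a w v [c wE] [c' vE]; exists (fun j => a * c j + c' j) => /=.
  rewrite wE vE scaler_sumr -big_split; apply: eq_bigr => j _.
  by rewrite /= scalerDl scalerA.
have nz : mu (vbasis {:U})`_(Ordinal N_gt0) (var ord0) != 0.
  rewrite form_mul_eq0 negb_or; apply/andP; split.
    apply: contra_eq_neq (coords_vbasis (Ordinal N_gt0) (Ordinal N_gt0)) => ->.
    by rewrite /coords linear0 eqxx eq_sym oner_neq0.
  exact: var_neq0.
have [P PE] := projspace_of nz; exists P.
exists (vbasis {:U})`_(Ordinal N_gt0), (var ord0); split=> //.
  exact: flag_forms_vbasis.
exact: flag_linear_var.
Qed.

(** Division by [x_0] on its image, followed by the coordinate added at step
    [i.+1]. *)
Lemma separator_forms i : (i < N.-1)%N -> exists e f,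
  [/\ f \is e.-homog, vanishes_on f (chain_image i) &
      ~ vanishes_on f (chain_image i.+1)].
Proof.
move=> ltiN; have ltSiN : (i.+1 < N)%N by lia.
pose k := Ordinal ltSiN.
pose T : 'Hom(U, dhomog r.+1 K d) := linfun (applyr mu (var ord0)).
have TE u : T u = mu u (var ord0) by rewrite lfunE.
have TK : cancel T (T^-1)%VF.
  apply/lker0_lfunK/lker0P => u u'; rewrite !TE => /eqP.
  rewrite -subr_eq0 -linearBl form_mul_eq0 subr_eq0 (negbTE (var_neq0 _)).
  by rewrite orbF => /eqP.
pose phi0 v : K := coords ((T^-1)%VF v) k.
have lin : scalar phi0 by move=> a y y'; rewrite /phi0 /coords !linearP.
pose phi : {scalar dhomog r.+1 K d} :=
  HB.pack phi0 (GRing.isLinear.Build _ _ _ _ _ lin).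
apply: (linear_separator (phi := phi) (u := (vbasis {:U})`_k) (w := var ord0)).
- move=> u w Lu; have -> : (i - N.-1 = 0)%N by lia.
  move=> /flag_linear0[a ->].
  have -> : mu u (a *: var ord0) = a *: T u by rewrite TE; exact: linearZr_LR.
  rewrite linearZ /= /phi0 TK; have -> : coords u k = 0 by exact: Lu.
  exact: mulr0.
- exact: flag_forms_vbasis.
- exact: flag_linear_var.
by rewrite -TE /= /phi0 TK [X in X != 0](coords_vbasis k k) eqxx oner_neq0.
Qed.

(** Evaluation at the coordinate point of the new variable [x_j] kills the span
    of the earlier variables, but not [x_j ^ e * x_j]. *)
Lemma separator_linear i : (N.-1 <= i)%N -> (i < N.-1 + r)%N -> exists e f,
  [/\ f \is e.-homog, vanishes_on f (chain_image i) &
      ~ vanishes_on f (chain_image i.+1)].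
Proof.
move=> leNi ltir; have ltj : (i.+1 - N.-1 < r.+1)%N by lia.
pose j := Ordinal ltj; pose x (k : 'I_r.+1) : K := (k == j)%:R.
pose phi0 (v : dhomog r.+1 K d) : K := (val v).@[x].
have lin : scalar phi0 by move=> a v v'; rewrite /phi0 /= mevalD mevalZ.
pose phi : {scalar dhomog r.+1 K d} :=
  HB.pack phi0 (GRing.isLinear.Build _ _ _ _ _ lin).
have Xe : ('X_j ^+ e : {mpoly K[r.+1]}) \is e.-homog.
  by have := dhomogMn e (homog_X K j); rewrite mul1n.
apply: (linear_separator (phi := phi) (u := DHomog Xe) (w := var j)).
- move=> u w _ [c wE]; rewrite /= /phi0 /= mevalM wE raddf_sum /=.
  rewrite big1 ?mulr0 // => k lek; rewrite mevalZ mevalXU /x.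
  case: eqP => [kj|]; last by rewrite mulr0.
  by move: lek; rewrite kj /=; lia.
- by apply: flag_formsT; apply: leqW.
- exact: flag_linear_var.
rewrite /= /phi0 /= mevalM rmorphXn /= mevalXU /x eqxx expr1n mulr1.
exact: oner_neq0.
Qed.

Lemma long_chain A : bilinear_image mu setT setT `<=` A ->
  exists c, irreducible_chain A (N.-1 + r) c.
Proof.
move=> subA; eexists; apply: (irreducible_chain_closures (Z := chain_image)).
- move=> i _; split; last exact: chain_image_irreducible.
  by move=> P [u [w [_ _ PE]]]; apply: subA; exists u, w.
- by move=> i _; exact: chain_image_sub.
move=> i lti; have [ltN|leN] := ltnP i N.-1; first exact: separator_forms.
exact: separator_linear.
Qed.

End LongChain.

Theorem proposition7p2 (K : closedFieldType) (charK : [pchar K] =i pred0)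
    (d n : nat) (hd : (2 <= d)%N) (hn : (3 <= n)%N) :
  has_krull_dim (reducible_forms K n.-1 d)
    ('C(d + n - 2, n - 1) + n - 2)%N /\
  has_krull_dim (reducible_split K n.-1 d 1)
    ('C(d + n - 2, n - 1) + n - 2)%N.
Proof.
have d1 : (d - 1 + 1 = d)%N by rewrite subnK // ltnW.
have sub1 : reducible_split K n.-1 d 1 `<=` reducible_forms K n.-1 d.
  by move=> P P1; exists 1%N => //=; lia.
have image_sub : bilinear_image (form_mul (K := K) (n := n.-1.+1) d1) setT setT
    `<=` reducible_split K n.-1 d 1.
  by rewrite (reducible_splitE K n.-1 d1).
have dimE : ('C(d + n - 2, n - 1) + n - 2 = ('C(d - 1 + n.-1, n.-1)).-1 + n.-1)%N.
  have -> : (d - 1 + n.-1 = d + n - 2)%N by lia.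
  have : (0 < 'C(d + n - 2, n.-1))%N by rewrite bin_gt0; lia.
  by rewrite subn1; lia.
have upper A : A `<=` reducible_forms K n.-1 d -> forall m c,
    irreducible_chain A m c -> (m <= 'C(d + n - 2, n - 1) + n - 2)%N.
  move=> subA m c; rewrite dimE subn1; apply: reducible_chain_bound subA.
  by lia.
have lower A : reducible_split K n.-1 d 1 `<=` A -> exists c,
    irreducible_chain A ('C(d + n - 2, n - 1) + n - 2)%N c.
  rewrite dimE (reducible_splitE K n.-1 d1) => /long_chain.
  by rewrite dim_dhomog -bin_sub ?leq_addr // addKn.
by split; split; [exact: lower|exact: upper|exact: lower|exact: upper].
Qed.
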